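(* Let $m\ge 1$ and let $K$ and $V$ be convex bodies in $\mathbb{R}^m$ that are centrally symmetric with respect to the origin. Then for any $\mathbf{a}\in\mathcal{A}(K,V)$ there exists $\mathbf{b}\in\mathcal{B}(V^*,K^* )$ such that $$M(K,V)=M(V^*,K^* )=|(\mathbf{b},\mathbf{a})|.$$
   Context: $(t,y)=\sum_{j=1}^m t_jy_j$ is the inner product on $\mathbb{R}^m$. A convex body is a compact convex set with non-empty interior; $\partial(V)$ is the boundary of $V$. For an origin-symmetric convex body $V$, its polar is $V^*=\{y\in\mathbb{R}^m: |(t,y)|\le 1 \text{ for all } t\in V\}$, again an origin-symmetric convex body, with $V^{**}=V$. The norm $\|x\|_V:=\max_{t\in V^*}|(t,x)|$ on $\mathbb{R}^m$ has unit ball $V$; likewise $\|y\|_{V^*}:=\max_{t\in V}|(t,y)|$. For origin-symmetric convex bodies $K,V$ define $$M(K,V):=\max_{y\in V}\|y\|_K=\max_{y\in\partial(V)}\|y\|_K=\max_{y\in\mathbb{R}^m\setminus\{0\}}\|y\|_K/\|y\|_V,$$ (so $M(V^*,K^* )=\max_{y\in K^*}\|y\|_{V^*}$), and $$\mathcal{A}(K,V):=\{\mathbf{a}\in\partial(V): \|\mathbf{a}\|_K=M(K,V)\},\qquad \mathcal{B}(V^*,K^* ):=\{\mathbf{b}\in\partial(K^* ): \|\mathbf{b}\|_{V^*}=M(V^*,K^* )\}.$$ *)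

(* Defs.v *)
From HB Require Import structures.
From mathcomp Require Import all_boot all_order all_algebra.
From mathcomp Require Import all_classical all_reals all_analysis.
Set Implicit Arguments.
Unset Strict Implicit.
Unset Printing Implicit Defensive.
Import Order.TTheory GRing.Theory Num.Theory.
Import numFieldNormedType.Exports.
Local Open Scope classical_set_scope.
Local Open Scope ring_scope.

(* The library topology on 'rV[R]_m comes from the sup norm; it is the usual
   topology of R^m, so compactness and interiors have their usual meaning. *)

Definition inner (R : realType) (m : nat) (t y : 'rV[R]_m) : R :=
  \sum_(j < m) t ord0 j * y ord0 j.

Definition boundary (T : topologicalType) (A : set T) : set T :=
  closure A `\` interior A.

Definition convex_body (R : realType) (m : nat) (V : set 'rV[R]_m) : Prop :=
  [/\ compact V, convex_set V & interior V !=set0].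

Definition origin_symmetric (R : realType) (m : nat) (V : set 'rV[R]_m) :
    Prop :=
  forall x, V x -> V (- x).

Definition polar (R : realType) (m : nat) (V : set 'rV[R]_m) :
    set 'rV[R]_m :=
  [set y | forall t, V t -> `|inner t y| <= 1].

(* For origin-symmetric convex bodies the sets below are nonempty and compact,
   so each sup is a maximum. At polar V, body_norm ranges over the bipolar of
   V, which is V itself by the bipolar theorem. *)
Definition body_norm (R : realType) (m : nat) (V : set 'rV[R]_m)
    (x : 'rV[R]_m) : R :=
  sup [set `|inner t x| | t in polar V].

Definition max_norm (R : realType) (m : nat) (K V : set 'rV[R]_m) : R :=
  sup [set body_norm K y | y in V].

(* The set A(K,V); with polars V' of V and K' of K, the set B(V',K') is
   maximizers V' K'. *)
Definition maximizers (R : realType) (m : nat) (K V : set 'rV[R]_m) :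
    set 'rV[R]_m :=
  [set a | boundary V a /\ body_norm K a = max_norm K V].

(* Main.v *)
Require Import Defs.
From mathcomp Require Import all_boot all_order all_algebra.
From mathcomp Require Import all_classical all_reals all_analysis.
Set Implicit Arguments.
Unset Strict Implicit.
Unset Printing Implicit Defensive.
Import Order.TTheory GRing.Theory Num.Theory.
Import numFieldNormedType.Exports.
Local Open Scope classical_set_scope.
Local Open Scope ring_scope.

(** Both [max_norm K V] and [max_norm (polar V) (polar K)] are the supremum of
    the pairing |(t, y)| over t in the polar of K and y in V, which makes them
    equal by symmetry of the inner product.  The one asymmetry is that the
    second quantity lets y range over the bipolar of V; but a bound M > 0 on
    |(t, y)| for y in V says that t / M lies in the polar of V, so it holds on
    the bipolar as well ([bipolar_inner_le]).

    For a maximizer a, the vector b is a point of the polar of K at which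
    |(t, a)| is largest.  It exists because the polar of a set with non-empty
    interior is compact ([compact_polar]), and the supremum M of the pairing is
    then |(b, a)|.  As M > 0 ([max_norm_gt0]), b lies on the boundary:
    otherwise some (1 + d) b with d > 0 would still be in the polar of K, and
    would pair with a to (1 + d) M > M in absolute value. *)

Lemma innerC (R : realType) (m : nat) (t y : 'rV[R]_m) : inner t y = inner y t.
Proof. by apply: eq_bigr => j _; rewrite mulrC. Qed.

Lemma innerZl (R : realType) (m : nat) (c : R) (t y : 'rV[R]_m) :
  inner (c *: t) y = c * inner t y.
Proof.
by rewrite /inner mulr_sumr; apply: eq_bigr => j _; rewrite mxE mulrA.
Qed.

Lemma innerDl (R : realType) (m : nat) (s t y : 'rV[R]_m) :
  inner (s + t) y = inner s y + inner t y.
Proof.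
by rewrite /inner -big_split; apply: eq_bigr => j _; rewrite mxE mulrDl.
Qed.

Lemma inner_delta (R : realType) (m : nat) (i : 'I_m) (y : 'rV[R]_m) :
  inner (delta_mx ord0 i) y = y ord0 i.
Proof.
rewrite /inner (bigD1 i) //= mxE !eqxx mul1r big1 ?addr0 // => j ji.
by rewrite mxE eqxx (negbTE ji) mul0r.
Qed.

Lemma inner_gt0 (R : realType) (m : nat) (y : 'rV[R]_m) :
  y != 0 -> 0 < inner y y.
Proof.
move=> y0; have sq_ge0 j : true -> 0 <= y ord0 j * y ord0 j.
  by move=> _; rewrite -expr2 sqr_ge0.
rewrite lt_def sumr_ge0 // andbT; apply: contra_neq y0 => /eqP.
rewrite psumr_eq0 // => /allP yj0; apply/rowP => j; rewrite mxE.
have /eqP := yj0 j (mem_index_enum j).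
by move/eqP; rewrite mulf_eq0 orbb => /eqP.
Qed.

Lemma inner_continuous (R : realType) (m : nat) (p : 'rV[R]_m * 'rV[R]_m) :
  {for p, continuous (fun q : 'rV[R]_m * 'rV[R]_m => inner q.1 q.2)}.
Proof.
apply: cvg_big => [|j _]; first exact: add_continuous.
by apply: cvgM; apply: continuous_comp (@coord_continuous _ _ _ _ _ _);
  [exact: cvg_fst | exact: cvg_snd].
Qed.

Lemma norm_inner_continuousl (R : realType) (m : nat) (y : 'rV[R]_m) :
  continuous (fun t : 'rV[R]_m => `|inner t y|).
Proof.
move=> t; apply: (@continuous_comp _ _ _ (fun t => inner t y) Num.norm).
  move: t; apply: continuous_big => [|j _ t]; first exact: add_continuous.
  by apply: continuousM; [exact: coord_continuous | exact: cst_continuous].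
exact: norm_continuous.
Qed.

Lemma compact_inner_bounded (R : realType) (m : nat) (A B : set 'rV[R]_m) :
  compact A -> compact B ->
  exists2 C, 0 < C & forall t y, A t -> B y -> `|inner t y| <= C.
Proof.
move=> cA cB; have /compact_bounded/pinfty_ex_gt0[C C0 AB_le] :
    compact ((fun q => inner q.1 q.2) @` (A `*` B)).
  apply: continuous_compact; last exact: compact_setX.
  by apply: continuous_subspaceT => q; exact: inner_continuous.
exists C => // t y At By; apply: AB_le.
by exists (t, y).
Qed.

Lemma interior_shift (R : realType) (m : nat) (A : set 'rV[R]_m)
    (x v : 'rV[R]_m) :
  interior A x -> exists2 d, 0 < d & A (x + d *: v).
Proof.
move=> Ax; have : (x + d *: v) @[d --> (0 : R)^'+] --> x + 0 *: v.
  apply: cvg_within_filter.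
  by apply: cvgD; [exact: cvg_cst | apply: cvgZr_tmp; exact: cvg_id].
rewrite scale0r addr0 => /(_ _ Ax) nA; near (0 : R)^'+ => d.
exists d; first by [].
by near: d.
Unshelve. all: by end_near. Qed.

(** Each coordinate of a point y of the polar is bounded: it is proportional to
    the difference of the pairings of y with two points of K that differ along
    the corresponding axis, and both pairings are at most 1 in absolute value. *)
Lemma compact_polar (R : realType) (m : nat) (K : set 'rV[R]_m) :
  interior K !=set0 -> compact (polar K).
Proof.
move=> [x Kx]; have coord_le (i : 'I_m) :
    exists C : R, forall y, polar K y -> `|y ord0 i| <= C.
  have [d d0 Kxd] := interior_shift (delta_mx ord0 i) Kx.
  exists (d^-1 * 2) => y Ky.
  rewrite ler_pdivlMl // -[d in d * _]gtr0_norm // -normrM -(inner_delta i y).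
  rewrite -innerZl -[inner _ _](addKr (inner x y)) -innerDl.
  rewrite (le_trans (ler_normD _ _)) // normrN [leRHS]mulr2n.
  rewrite lerD //; apply: Ky => //.
  exact: interior_subset.
have [C CE] := choice coord_le.
(* The polar is a closed subset of the box with half-sides C i. *)
have box := rV_compact (fun i => @segment_compact R (- C i) (C i)).
apply: (subclosed_compact _ box); last first.
  by move=> y Ky i /=; rewrite in_itv /= -ler_norml; exact: CE.
have -> : polar K = \bigcap_(t in K) [set y | `|inner y t| <= 1].
  by apply/seteqP; split=> y Ky t Kt; have := Ky t Kt; rewrite /= innerC.
apply: closed_bigI => t _.
apply: (@preimage_closed _ _ (fun y => `|inner y t|) [set r | r <= 1]).
  by move=> y _; exact: norm_inner_continuousl.
exact: closed_le.
Qed.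

Lemma polar0 (R : realType) (m : nat) (V : set 'rV[R]_m) : polar V 0.
Proof.
by move=> t _; rewrite innerC -(scale0r 0) innerZl mul0r normr0 ler01.
Qed.

Lemma polarVZ (R : realType) (m : nat) (V : set 'rV[R]_m) (M : R)
    (y : 'rV[R]_m) :
  0 < M -> (forall t, V t -> `|inner t y| <= M) -> polar V (M^-1 *: y).
Proof.
move=> M0 yM t Vt; rewrite innerC innerZl innerC normrM gtr0_norm ?invr_gt0 //.
by rewrite ler_pdivrMl // mulr1 yM.
Qed.

Lemma sub_bipolar (R : realType) (m : nat) (V : set 'rV[R]_m) :
  V `<=` polar (polar V).
Proof. by move=> t Vt s Vs; rewrite innerC; exact: Vs. Qed.

(** The bound rescales y into the polar of V, and a point of the bipolar is by
    definition one that pairs to at most 1 with the polar. *)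
Lemma bipolar_inner_le (R : realType) (m : nat) (V : set 'rV[R]_m) (M : R)
    (y : 'rV[R]_m) :
  0 < M -> (forall t, V t -> `|inner t y| <= M) ->
  forall t, polar (polar V) t -> `|inner t y| <= M.
Proof.
move=> M0 yM t Vt; have := Vt _ (polarVZ M0 yM).
by rewrite innerZl innerC normrM gtr0_norm ?invr_gt0 // ler_pdivrMl // mulr1.
Qed.

Lemma body_norm_le (R : realType) (m : nat) (K : set 'rV[R]_m) (M : R)
    (y : 'rV[R]_m) :
  (forall t, polar K t -> `|inner t y| <= M) -> body_norm K y <= M.
Proof.
move=> yM; apply: ge_sup => [|_ [t Kt <-]]; last exact: yM.
by exists `|inner 0 y|, 0 => //; exact: polar0.
Qed.

(** The bound M keeps the supremum defining [body_norm K y] from being the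
    default value of [sup] on an unbounded set. *)
Lemma inner_le_body_norm (R : realType) (m : nat) (K : set 'rV[R]_m) (M : R)
    (t y : 'rV[R]_m) :
  (forall s, polar K s -> `|inner s y| <= M) -> polar K t ->
  `|inner t y| <= body_norm K y.
Proof.
move=> yM Kt; apply: ub_le_sup; last by exists t.
by exists M => _ [s Ks <-]; exact: yM.
Qed.

Lemma inner_le_max_norm (R : realType) (m : nat) (K V : set 'rV[R]_m)
    (t y : 'rV[R]_m) :
  interior K !=set0 -> compact V -> polar K t -> V y ->
  `|inner t y| <= max_norm K V.
Proof.
move=> /compact_polar cK cV Kt Vy.
have [C _ le_C] := compact_inner_bounded cK cV.
apply: (le_trans (inner_le_body_norm (fun s Ks => le_C s y Ks Vy) Kt)).
apply: ub_le_sup; last by exists y.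
by exists C => _ [z Vz <-]; apply: body_norm_le => s Ks; exact: le_C.
Qed.

(** Boundedness of K puts a positive multiple of any given y in the polar of
    K, and y pairs positively with it as soon as y is non-zero. *)
Lemma max_norm_gt0 (R : realType) (m : nat) (K V : set 'rV[R]_m) :
  (1 <= m)%N -> compact K -> interior K !=set0 ->
  compact V -> interior V !=set0 -> 0 < max_norm K V.
Proof.
move=> m1 cK intK cV [x Vx].
(* If the interior point is the origin, move off it along the first axis. *)
have [y Vy y0] : exists2 y, V y & y != 0.
  have [x0|x0] := eqVneq x 0; last by exists x => //; exact: interior_subset.
  have [d d0] := interior_shift (delta_mx ord0 (Ordinal m1)) Vx.
  rewrite x0 add0r => Vd; exists (d *: delta_mx ord0 (Ordinal m1)) => //.
  rewrite scaler_eq0 (gt_eqF d0) /=; apply/eqP => /rowP/(_ (Ordinal m1))/eqP.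
  by rewrite !mxE !eqxx oner_eq0.
have [C C0 le_C] := compact_inner_bounded cK (@compact_set1 _ y).
have Ky := polarVZ C0 (fun t Kt => le_C t y Kt erefl).
apply: lt_le_trans (inner_le_max_norm intK cV Ky Vy).
by rewrite innerZl normr_gt0 mulf_neq0 // ?invr_eq0 gt_eqF // inner_gt0.
Qed.

Theorem proposition1p1 (R : realType) (m : nat) (m_ge1 : (1 <= m)%N)
    (K V : set 'rV[R]_m)
    (K_body : convex_body K) (K_sym : origin_symmetric K)
    (V_body : convex_body V) (V_sym : origin_symmetric V)
    (a : 'rV[R]_m) (aA : maximizers K V a) :
  exists b : 'rV[R]_m, maximizers (polar V) (polar K) b /\
    max_norm K V = max_norm (polar V) (polar K) /\
    max_norm (polar V) (polar K) = `|inner b a|.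
Proof.
have [cK _ intK] := K_body; have [cV _ intV] := V_body.
have [[clVa _] aM] := aA.
have Va : V a by apply: (compact_closed (@norm_hausdorff _ _) cV).
have M_gt0 := max_norm_gt0 m_ge1 cK intK cV intV.
have pairing_le t y : polar K t -> V y -> `|inner t y| <= max_norm K V.
  exact: inner_le_max_norm.
have cpK := compact_polar intK.
have [b Kb b_max] : exists2 b, polar K b &
    forall t, polar K t -> `|inner t a| <= `|inner b a|.
  have [||b] := @compact_EVT_max _ R (fun t => `|inner t a|) (polar K) _ cpK.
  - by exists 0; exact: polar0.
  - by apply: continuous_subspaceT; exact: norm_inner_continuousl.
  rewrite inE => Kb b_max; exists b => // t Kt; apply: b_max; rewrite inE.
  exact: Kt.
(* As a is a maximizer, M is body_norm K a, a supremum attained at b. *)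
have baM : `|inner b a| = max_norm K V.
  by apply/le_anti; rewrite pairing_le //= -aM; exact: body_norm_le.
have bipolar_le y t :
    polar K y -> polar (polar V) t -> `|inner t y| <= max_norm K V.
  move=> Ky; apply: bipolar_inner_le => // s Vs.
  by rewrite innerC; exact: pairing_le.
have bM : body_norm (polar V) b = max_norm K V.
  apply/le_anti; rewrite body_norm_le /= => [|t]; last exact: bipolar_le.
  rewrite -baM innerC; apply: (inner_le_body_norm (bipolar_le b ^~ Kb)).
  exact: sub_bipolar.
have dualM : max_norm (polar V) (polar K) = max_norm K V.
  apply/le_anti/andP; split.
    apply: ge_sup => [|_ [y Ky <-]]; first by exists (body_norm (polar V) b), b.
    by apply: body_norm_le => t; exact: bipolar_le.
  rewrite -bM; apply: ub_le_sup; last by exists b.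
  exists (max_norm K V) => _ [y Ky <-].
  by apply: body_norm_le => t; exact: bipolar_le.
exists b; rewrite dualM baM; split=> //; split; last by rewrite bM dualM.
split; first exact: subset_closure.
(* The shift of b by d b would pair with a to (1 + d) M in absolute value. *)
move=> /(interior_shift b)[d d0 Kdb].
have := pairing_le _ _ Kdb Va; apply/negP; rewrite -ltNge -baM.
rewrite innerDl innerZl -{2}[inner b a]mul1r -mulrDl normrM.
rewrite gtr0_norm; last by rewrite ltr_wpDl.
by rewrite ltr_pMl ?ltrDl // baM.
Qed.
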